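(* Let $(A,M,R,S)$ be an $\mathcal{O}$-operator system associated to $(M,\triangleright,\triangleleft)$. Then $(M,\ast)$, with $\ast:M\otimes M\to M$ defined for all $x,y\in M$ by $$x\ast y=R(x)\triangleright y-y\triangleleft S(x),$$ is a pre-Lie algebra.
   Context: All vector spaces, linear maps and tensor products are over a field $K$; associative algebras are not assumed to be unital. An $A$-bimodule $(M,\triangleright,\triangleleft)$ is a vector space $M$ with linear maps $\triangleright:A\otimes M\to M$, $\triangleleft:M\otimes A\to M$ such that $a\triangleright(b\triangleright x)=(ab)\triangleright x$, $(x\triangleleft a)\triangleleft b=x\triangleleft(ab)$, $(a\triangleright x)\triangleleft b=a\triangleright(x\triangleleft b)$ for all $a,b\in A$, $x\in M$. $\mathcal{O}$-operator system: for an associative algebra $A$, an $A$-bimodule $(M,\triangleright,\triangleleft)$ and linear maps $R,S:M\to A$, $(A,M,R,S)$ is an $\mathcal{O}$-operator system associated to $(M,\triangleright,\triangleleft)$ if for all $x,y\in M$: $R(x)R(y)=R(R(x)\triangleright y+x\triangleleft S(y))$ and $S(x)S(y)=S(R(x)\triangleright y+x\triangleleft S(y))$. (Left) pre-Lie algebra $(M,\ast)$: $(x\ast y)\ast z-x\ast(y\ast z)=(y\ast x)\ast z-y\ast(x\ast z)$ for all $x,y,z\in M$. *)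

(* Defs.v *)
From HB Require Import structures.
From mathcomp Require Import all_boot all_order all_algebra.

Set Implicit Arguments.
Unset Strict Implicit.
Unset Printing Implicit Defensive.

Import GRing.Theory.
Local Open Scope ring_scope.

(* The library's algebra structures (lalgType, algType) are unital, so a
   not necessarily unital associative K-algebra is given by an lmodType A
   with a bilinear product mul such that [associative mul].  A linear map out
   of a tensor product U (x) V is a bilinear map [{bilinear U -> V -> W}]. *)

Record bimodule (K : fieldType) (A M : lmodType K)
    (mul : {bilinear A -> A -> A})
    (lact : {bilinear A -> M -> M}) (ract : {bilinear M -> A -> M}) : Prop :=
  Bimodule {
    bimod_lact : forall (a b : A) (x : M),
      lact a (lact b x) = lact (mul a b) x;
    bimod_ract : forall (x : M) (a b : A),
      ract (ract x a) b = ract x (mul a b);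
    bimod_lract : forall (a : A) (x : M) (b : A),
      ract (lact a x) b = lact a (ract x b)
  }.

Record O_operator_system (K : fieldType) (A M : lmodType K)
    (mul : {bilinear A -> A -> A})
    (lact : {bilinear A -> M -> M}) (ract : {bilinear M -> A -> M})
    (R S : {linear M -> A}) : Prop :=
  OOperatorSystem {
    O_assoc : associative mul;
    O_bimod : bimodule mul lact ract;
    O_eqR : forall x y : M,
      mul (R x) (R y) = R (lact (R x) y + ract x (S y));
    O_eqS : forall x y : M,
      mul (S x) (S y) = S (lact (R x) y + ract x (S y))
  }.

Record preLie_algebra (K : fieldType) (M : lmodType K) (ast : M -> M -> M) :
    Prop :=
  PreLieAlgebra {
    preLie_bilinear : bilinear_for *:%R *:%R ast;
    preLie_identity : forall x y z : M,
      ast (ast x y) z - ast x (ast y z) = ast (ast y x) z - ast y (ast x z)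
  }.

(* Main.v *)
Require Import Defs.
From HB Require Import structures.
From mathcomp Require Import all_boot all_order all_algebra.

Set Implicit Arguments.
Unset Strict Implicit.
Unset Printing Implicit Defensive.

Import GRing.Theory.
Local Open Scope ring_scope.

(** Write x ∘ y for R x ▷ y + x ◁ S y.  The product x ∗ y = R x ▷ y - y ◁ S x
    has the same commutator as ∘, and R and S send ∘ to the product of A;
    hence R and S turn commutators of ∗ into commutators of A
    ([O_operator_commutator]).  On the other side, left multiplication by x is
    the operator L_x z = R x ▷ z - z ◁ S x, and the bimodule axioms give
    [L_x, L_y] z = [R x, R y] ▷ z - z ◁ [S x, S y], because the mixed terms
    - R x ▷ z ◁ S y - R y ▷ z ◁ S x of L_x (L_y z) are symmetric in x and y
    ([bimodule_act_commutator]).  Therefore [L_x, L_y] is left multiplication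
    by x ∗ y - y ∗ x, which is the pre-Lie identity. *)

(** A pair (a, b) acts on M by z ↦ a ▷ z - z ◁ b; the commutator of two such
    operators is the operator of the componentwise commutator. *)
Lemma bimodule_act_commutator (K : fieldType) (A M : lmodType K)
    (mul : {bilinear A -> A -> A})
    (lact : {bilinear A -> M -> M}) (ract : {bilinear M -> A -> M})
    (a a' b b' : A) (z : M) :
  bimodule mul lact ract ->
  let act c d w := lact c w - ract w d in
  act (mul a a' - mul a' a) (mul b b' - mul b' b) z
    = act a b (act a' b' z) - act a' b' (act a b z).
Proof.
move=> [lactA ractA lractA] /=.
rewrite !(linearBl, linearBr) /= !lactA !ractA !lractA !opprB.
(* Pair the summands so that the mixed terms telescope. *)
rewrite [RHS]addrACA !subrKA.
by rewrite [LHS]addrACA [RHS]addrACA [X in _ = _ + X]addrC.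
Qed.

Lemma O_operator_commutator (K : fieldType) (A M : lmodType K)
    (mul : {bilinear A -> A -> A})
    (lact : {bilinear A -> M -> M}) (ract : {bilinear M -> A -> M})
    (R S : {linear M -> A}) (x y : M) :
  O_operator_system mul lact ract R S ->
  let ast u v := lact (R u) v - ract v (S u) in
  R (ast x y - ast y x) = mul (R x) (R y) - mul (R y) (R x) /\
  S (ast x y - ast y x) = mul (S x) (S y) - mul (S y) (S x).
Proof.
move=> [_ _ eqR eqS] ast.
have -> : ast x y - ast y x
    = (lact (R x) y + ract x (S y)) - (lact (R y) x + ract y (S x)).
  by rewrite /ast opprB opprD [LHS]addrACA [X in _ + X = _]addrC.
by rewrite !eqR !eqS !raddfB.
Qed.

Theorem corollary3p26 (K : fieldType) (A M : lmodType K)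
    (mul : {bilinear A -> A -> A})
    (lact : {bilinear A -> M -> M}) (ract : {bilinear M -> A -> M})
    (R S : {linear M -> A})
    (hRS : O_operator_system mul lact ract R S) :
  preLie_algebra (fun x y : M => lact (R x) y - ract y (S x)).
Proof.
have [_ bimod _ _] := hRS; split.
  split=> [y c x x'|x c y y'] /=.
    by rewrite !linearP linearPl /= addrACA -scalerDr.
  by rewrite linearPl linearPr /= scalerBr opprD addrACA.
move=> x y z.
set ast := fun u v : M => lact (R u) v - ract v (S u).
have astBl u v : ast u z - ast v z = ast (u - v) z.
  rewrite /ast (linearB R) (linearB S) linearBl linearBr /=.
  by rewrite [in LHS]opprD [in RHS]opprD addrACA.
have [eqR eqS] := O_operator_commutator x y hRS.
have /= actE := bimodule_act_commutator (R x) (R y) (S x) (S y) z bimod.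
have commE :
  ast (ast x y) z - ast (ast y x) z = ast x (ast y z) - ast y (ast x z).
  by rewrite astBl -actE -eqR -eqS.
(* The pre-Lie identity is commE with two terms exchanged across the equality. *)
by apply/eqP; rewrite subr_eq addrAC -addrA addrC -subr_eq commE.
Qed.
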